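(* Let $N \geq 2$ be an integer and let $\alpha$ be a finite constant with $\alpha>0$. There is no positive function $u \in C^{2N}(\mathbf{R}^{2N-1})$ satisfying $$(-\Delta)^N u = u^{-(4N-1)} \quad \text{in } \mathbf{R}^{2N-1}$$ and $$\lim_{|x|\to+\infty} \frac{u(x)}{|x|} = \alpha \quad \text{uniformly.}$$
   Context: Here $\Delta$ is the Euclidean Laplacian and $(-\Delta)^N$ its $N$-th iterate. ''Uniformly'' means uniformly with respect to the direction $x/|x|$, i.e. the limit is the ordinary limit as $|x|\to+\infty$. *)

(* Defs.v *)
From mathcomp Require Import all_boot all_order all_algebra.
From mathcomp Require Import all_classical all_reals all_analysis.
Set Implicit Arguments.
Unset Strict Implicit.
Unset Printing Implicit Defensive.
Import Order.TTheory GRing.Theory Num.Theory.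
Import numFieldNormedType.Exports.
Local Open Scope classical_set_scope.
Local Open Scope ring_scope.

Section EuclideanSpace.
Context {R : realType} {n : nat}.
Implicit Types (f : 'rV[R]_n -> R) (x : 'rV[R]_n).

(* The library norm `|x| on 'rV[R]_n is the sup norm, hence this definition. *)
Definition enorm x : R := Num.sqrt (\sum_(i < n) x 0 i ^+ 2).

(* The filter "|x| --> +oo" for the Euclidean norm. *)
Definition enorm_pinfty : set_system 'rV[R]_n :=
  filter_from [set: R] (fun M => [set x | M < enorm x]).

Global Instance enorm_pinfty_filter : Filter enorm_pinfty.
Proof.
apply: filter_from_filter; first by exists 0.
move=> M M' _ _; exists (Num.max M M') => // x /=.
by rewrite gt_max => /andP[].
Qed.

Definition partial (i : 'I_n) f : 'rV[R]_n -> R := 'D_(delta_mx 0 i) f.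

(* All iterated partial derivatives of order at most k exist everywhere and are
   continuous. Existence has to be required explicitly because 'D_v is total. *)
Fixpoint of_class_C (k : nat) f : Prop :=
  continuous f /\
  if k is k'.+1 then
    forall i : 'I_n, (forall x, derivable f x (delta_mx 0 i)) /\
                     of_class_C k' (partial i f)
  else True.

Definition laplacian f x : R := \sum_(i < n) partial i (partial i f) x.

Definition neg_laplacian f x : R := - laplacian f x.

End EuclideanSpace.

(* Main.v *)
(** Since u grows like alpha |x| while (-Delta)^N |x| is a negative multiple of
    the Dirac mass at 0 in dimension 2N-1, the sign of (-Delta)^N u is wrong.
    Quantitatively, put b = (1+|x|^2)^(1/2), so that (-Delta)^N b = d b^(1-4N)
    with d < 0, and g = u - alpha b. Then g = o(|x|), while (-Delta)^N g is
    positive and bounded below on the unit cube. No integration is needed: let L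
    be the discrete analogue of -Delta built from difference quotients of step
    h, and let B average over the points of the lattice of step h in a cube of
    side l. A telescoping sum turns B applied to a difference quotient of step h
    into averages of difference quotients of step l, so B^(2N) L^N g is
    o(l^(1-2N)) near 0, uniformly in h. On the other hand L^N g tends to
    (-Delta)^N g uniformly on compact sets as h -> 0 (iterated mean value
    theorem), and the sum of its integer translates over a lattice cube of side
    comparable to l, hence with O(l^(2N-1)) points, is bounded below by a
    constant. Letting h -> 0 and then l -> oo is contradictory. *)
Require Import Defs.
From mathcomp Require Import all_boot all_order all_algebra.
From mathcomp Require Import all_classical all_reals all_analysis.
From mathcomp Require Import ring lra zify.
Import Order.TTheory GRing.Theory Num.Theory.
Import numFieldNormedType.Exports.
Local Open Scope classical_set_scope.
Local Open Scope ring_scope.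

(** * Finite linear combinations of translates and their commutation *)

Section TranslationOperators.
Context {R : realType} {V : zmodType}.
Implicit Types (T : (V -> R) -> V -> R) (F : V -> R).

(** Convolution with a finitely supported measure. Difference quotients, lattice averages and
    discrete Laplacians all have this form, so they commute with one another and with translations,
    whatever the regularity of the function. *)
Definition translation_op T :=
  exists s : seq (R * V), T = fun F x => \sum_(p <- s) p.1 * F (x + p.2).

Lemma translation_op_comm T T' F :
  translation_op T -> translation_op T' -> T (T' F) = T' (T F).
Proof.
move=> [s ->] [s' ->]; apply/funext => x.
under eq_bigr do rewrite mulr_sumr.
rewrite exchange_big /=; apply: eq_bigr => p' _.
rewrite mulr_sumr; apply: eq_bigr => p _.
by rewrite mulrCA addrAC.
Qed.

Lemma translation_op_id : translation_op id.
Proof.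
exists [:: (1, 0)]; apply/funext => F; apply/funext => x /=.
by rewrite big_seq1 mul1r addr0.
Qed.

Lemma translation_op_comp T T' :
  translation_op T -> translation_op T' -> translation_op (T \o T').
Proof.
move=> [s ->] [s' ->].
exists [seq (p.1 * p'.1, p.2 + p'.2) | p <- s, p' <- s'].
apply/funext => F; apply/funext => x /=; rewrite big_allpairs_dep.
apply: eq_bigr => p _; rewrite mulr_sumr; apply: eq_bigr => p' _ /=.
by rewrite mulrA addrA.
Qed.

Lemma translation_op_iter T k : translation_op T -> translation_op (iter k T).
Proof.
move=> tT; elim: k => [|k IH]; first exact: translation_op_id.
exact: translation_op_comp tT IH.
Qed.

Lemma translation_op_foldr (I : Type) (T : I -> (V -> R) -> V -> R) (s : seq I) :
  (forall i, translation_op (T i)) -> translation_op (fun F => foldr T F s).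
Proof.
move=> tT; elim: s => [|i s IH]; first exact: translation_op_id.
exact: translation_op_comp (tT i) IH.
Qed.

Lemma translation_op_sum T (I : Type) (r : seq I) (G : I -> V -> R) :
  translation_op T ->
  T (fun x => \sum_(i <- r) G i x) = fun x => \sum_(i <- r) T (G i) x.
Proof.
move=> [s ->]; apply/funext => x; rewrite exchange_big /=.
by apply: eq_bigr => p _; rewrite mulr_sumr.
Qed.

Lemma translation_opN T F :
  translation_op T -> T (fun x => - F x) = fun x => - T F x.
Proof.
move=> [s ->]; apply/funext => x; rewrite -sumrN.
by apply: eq_bigr => p _; rewrite mulrN.
Qed.

Lemma translation_opBZ T F G a :
  translation_op T ->
  T (fun x => F x - a * G x) = fun x => T F x - a * T G x.
Proof.
move=> [s ->]; apply/funext => x; rewrite mulr_sumr -sumrB.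
by apply: eq_bigr => p _; rewrite mulrBr mulrCA.
Qed.

Lemma translation_op_shift T F y :
  translation_op T -> T (fun x => F (x - y)) = fun x => T F (x - y).
Proof.
by move=> [s ->]; apply/funext => x; apply: eq_bigr => p _; rewrite addrAC.
Qed.

End TranslationOperators.

(** * Difference quotients and lattice averages *)

Section DifferenceOperators.
Context {R : realType} {n : nat}.
Implicit Types (F G : 'rV[R]_n -> R) (x y : 'rV[R]_n) (i j : 'I_n).

Let e i : 'rV[R]_n := delta_mx 0 i.

Definition diffq (h : R) i F x : R := h^-1 * (F (x + h *: e i) - F x).

Definition avg (h : R) (M : nat) i F x : R :=
  M%:R^-1 * \sum_(k < M) F (x + (k%:R * h) *: e i).

Definition cube_avg (h : R) (M : nat) F : 'rV[R]_n -> R :=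
  foldr (avg h M) F (enum 'I_n).

(** Both differences are forward rather than centred, so that each is telescoped by an average [avg]
    in the same direction. *)
Definition diff_neg_laplacian (h : R) F x : R :=
  - \sum_(i < n) diffq h i (diffq h i F) x.

Lemma translation_op_diffq h i : translation_op (diffq h i).
Proof.
exists [:: (h^-1, h *: e i); (- h^-1, 0)].
apply/funext => F; apply/funext => x.
by rewrite big_cons big_seq1 /= addr0 mulNr -mulrBr.
Qed.

Lemma translation_op_avg h M i : translation_op (avg h M i).
Proof.
exists [seq (M%:R^-1, (k%:R * h) *: e i) | k : 'I_M].
apply/funext => F; apply/funext => x.
by rewrite big_image /= /avg mulr_sumr.
Qed.

Lemma translation_op_cube_avg h M : translation_op (cube_avg h M).
Proof.
by apply: translation_op_foldr => i; exact: translation_op_avg.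
Qed.

Lemma translation_op_diff_neg_laplacian h :
  translation_op (diff_neg_laplacian h).
Proof.
pose T2 i := diffq h i \o diffq h i.
have t2 i : translation_op (T2 i).
  by apply: translation_op_comp; exact: translation_op_diffq.
have [s sE] := choice t2.
exists [seq (- p.1, p.2) | p <- flatten [seq s i | i <- enum 'I_n]].
apply/funext => F; apply/funext => x.
rewrite big_map big_flatten big_map big_enum /= /diff_neg_laplacian -sumrN.
apply: eq_bigr => i _; have -> : diffq h i (diffq h i F) = T2 i F by [].
by rewrite sE -sumrN; apply: eq_bigr => p _ /=; rewrite mulNr.
Qed.

Lemma norm_delta_mx i : `|e i| <= 1.
Proof.
rewrite -[`|_|]/(mx_norm _) mx_normrE; apply/bigmax_leP; split => // -[a b] _ /=.
by rewrite mxE; case: (_ && _); rewrite ?normr1 ?normr0.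
Qed.

Lemma norm_addZ_le x (c : R) i : `|x + c *: e i| <= `|x| + `|c|.
Proof.
apply: (le_trans (ler_normD _ _)); rewrite lerD2l normrZ.
by rewrite ler_piMr // norm_delta_mx.
Qed.

(** The two constants are kept apart because the slope [C1] will be chosen small before [C0] is
    known. *)
Definition lin_growth (C0 C1 : R) F := forall x, `|F x| <= C0 + C1 * `|x|.

Lemma avg_growth h M i F C0 C1 r :
  0 <= h -> M%:R * h <= r -> 0 <= C1 -> 0 <= C0 ->
  lin_growth C0 C1 F -> lin_growth (C0 + C1 * r) C1 (avg h M i F).
Proof.
move=> h0 Mr C10 C00 gF x; rewrite /avg normrM normfV normr_nat.
have b0 : 0 <= C0 + C1 * r + C1 * `|x|.
  have r0 : 0 <= r by apply: le_trans Mr; rewrite mulr_ge0.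
  by rewrite !addr_ge0 ?mulr_ge0.
(* For [M = 0] the average is 0, since [0^-1 = 0]. *)
case: M Mr => [|M] Mr; first by rewrite invr0 mul0r.
rewrite mulrC ler_pdivrMr ?ltr0n //.
apply: (le_trans (ler_norm_sum _ _ _)).
have -> : (C0 + C1 * r + C1 * `|x|) * M.+1%:R =
          \sum_(k < M.+1) (C0 + C1 * r + C1 * `|x|).
  by rewrite sumr_const card_ord mulr_natr.
apply: ler_sum => k _; apply: (le_trans (gF _)).
rewrite -addrA lerD2l -mulrDr ler_wpM2l // [r + _]addrC.
apply: (le_trans (norm_addZ_le _ _ _)); rewrite lerD2l.
rewrite ger0_norm ?mulr_ge0 //; apply: le_trans Mr.
by rewrite ler_wpM2r // ler_nat ltnW.
Qed.

Lemma foldr_avg_growth h M s F C0 C1 r :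
  0 <= h -> M%:R * h <= r -> 0 <= C1 -> 0 <= C0 ->
  lin_growth C0 C1 F ->
  lin_growth (C0 + C1 * (r *+ size s)) C1 (foldr (avg h M) F s).
Proof.
move=> h0 Mr C10 C00 gF.
have r0 : 0 <= r by apply: le_trans Mr; rewrite mulr_ge0.
elim: s => [|i s IH] /=; first by rewrite mulr0n mulr0 addr0.
rewrite mulrSr mulrDr addrA; apply: avg_growth => //.
by rewrite addr_ge0 // mulr_ge0 // mulrn_wge0.
Qed.

(* The sum defining the average telescopes. *)
Lemma avg_diffq h M i F x : h != 0 -> (0 < M)%N ->
  avg h M i (diffq h i F) x = (M%:R * h)^-1 * (F (x + (M%:R * h) *: e i) - F x).
Proof.
move=> h0 M0; rewrite /avg /diffq -mulr_sumr mulrA -invfM; congr (_ * _).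
have -> : F x = F (x + (0%:R * h) *: e i) by rewrite mul0r scale0r addr0.
rewrite -[in RHS](@telescope_sumr _ 0 M (fun k => F (x + (k%:R * h) *: e i))) //.
rewrite big_mkord; apply: eq_bigr => k _; congr (F _ - _).
by rewrite -addrA -scalerDl mulrSr mulrDl mul1r.
Qed.

(** After telescoping, only two values of [F] at distance [r] remain, divided by [r]: the bound
    gains [2 / r] and depends on [h] only through [r]. *)
Lemma avg_diffq_growth h M i F C0 C1 :
  0 < h -> (0 < M)%N -> 0 <= C0 -> 0 <= C1 -> lin_growth C0 C1 F ->
  let r := M%:R * h in
  lin_growth (2 / r * (C0 + C1 * r)) (2 / r * C1) (avg h M i (diffq h i F)).
Proof.
move=> h0 M0 C00 C10 gF r x.
have r0 : 0 < r by rewrite mulr_gt0 ?ltr0n.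
rewrite avg_diffq ?gt_eqF // normrM normfV (gtr0_norm r0) -/r.
have -> : 2 / r * (C0 + C1 * r) + 2 / r * C1 * `|x| =
    r^-1 * (2 * (C0 + C1 * r + C1 * `|x|)) by ring.
apply: ler_wpM2l; first by rewrite invr_ge0 ltW.
apply: (le_trans (ler_normB _ _)).
have H1 := gF x; have H2 := gF (x + r *: e i).
have := norm_addZ_le x r i; rewrite (gtr0_norm r0) => /(ler_wpM2l C10).
have : 0 <= C1 * r by rewrite mulr_ge0 // ltW.
rewrite mulrDr; lra.
Qed.

(** The average in direction [i] is commuted next to the difference quotient, where it telescopes;
    each of the other averages only moves the base point by at most [r]. *)
Lemma foldr_avg_diffq_growth h M i s F C0 C1 :
  0 < h -> (0 < M)%N -> 0 <= C0 -> 0 <= C1 -> lin_growth C0 C1 F -> i \in s ->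
  let r := M%:R * h in
  lin_growth (2 / r * (C0 + C1 * (r *+ size s))) (2 / r * C1)
    (foldr (avg h M) (diffq h i F) s).
Proof.
move=> h0 M0 C00 C10 gF + r.
have r0 : 0 < r by rewrite mulr_gt0 ?ltr0n.
have r0' := ltW r0.
have hh := ltW h0.
elim: s => //= j s IH; rewrite in_cons; have [<- _|_ /= /IH gs] := eqVneq i j.
  have -> : avg h M i (foldr (avg h M) (diffq h i F) s) =
      foldr (avg h M) (avg h M i (diffq h i F)) s.
    apply: (translation_op_comm (avg h M i) (fun F => foldr (avg h M) F s)).
      exact: translation_op_avg.
    by apply: translation_op_foldr => k; exact: translation_op_avg.
  have -> : 2 / r * (C0 + C1 * (r *+ (size s).+1)) =
      2 / r * (C0 + C1 * r) + 2 / r * C1 * (r *+ size s) by rewrite mulrS; ring.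
  apply: foldr_avg_growth => //; last exact: avg_diffq_growth.
  - by rewrite mulr_ge0 // divr_ge0.
  - by rewrite mulr_ge0 ?divr_ge0 // addr_ge0 ?mulr_ge0.
have -> : 2 / r * (C0 + C1 * (r *+ (size s).+1)) =
    2 / r * (C0 + C1 * (r *+ size s)) + 2 / r * C1 * r by rewrite mulrSr; ring.
apply: avg_growth => //; first by rewrite mulr_ge0 // divr_ge0.
by rewrite mulr_ge0 ?divr_ge0 // addr_ge0 ?mulr_ge0 // mulrn_wge0.
Qed.

Lemma cube_avg_diffq_growth h M i F C0 C1 :
  0 < h -> (0 < M)%N -> 0 <= C0 -> 0 <= C1 -> lin_growth C0 C1 F ->
  let r := M%:R * h in
  lin_growth (2 / r * (C0 + C1 * (r *+ n))) (2 / r * C1)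
    (cube_avg h M (diffq h i F)).
Proof.
move=> h0 M0 C00 C10 gF r.
rewrite -{1}(size_enum_ord n); apply: foldr_avg_diffq_growth => //.
by rewrite mem_enum.
Qed.

(** Commutation gives each of the two differences in a second difference a cube average of its
    own. *)
Lemma cube_avg2_diff_neg_laplacian h M F :
  cube_avg h M (cube_avg h M (diff_neg_laplacian h F)) =
  fun x => - \sum_(i < n) cube_avg h M (diffq h i (cube_avg h M (diffq h i F))) x.
Proof.
have tB := translation_op_cube_avg h M.
rewrite /diff_neg_laplacian !translation_opN //; apply/funext => x; congr (- _).
rewrite !translation_op_sum //; apply: eq_bigr => i _.
by rewrite (translation_op_comm _ _ _ tB (translation_op_diffq h i)).
Qed.

(** Each discrete Laplacian, paired with two cube averages, gains the factor [k]: [n] directions,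
    and [2 / r] per difference. The term [r *+ n *+ (2 * N)] bounds the total drift of the base
    point over [2 * N] cube averages. *)
Lemma iter_cube_avg_growth h M N F C0 C1 :
  0 < h -> (0 < M)%N -> 0 <= C0 -> 0 <= C1 -> lin_growth C0 C1 F ->
  let r := M%:R * h in
  let k := n%:R * (2 / r) ^+ 2 in
  lin_growth (k ^+ N * (C0 + C1 * (r *+ n *+ (2 * N)))) (k ^+ N * C1)
    (iter (2 * N) (cube_avg h M) (iter N (diff_neg_laplacian h) F)).
Proof.
move=> h0 M0 + + + r k.
have r0 : 0 < r by rewrite mulr_gt0 ?ltr0n.
have q0 : 0 <= 2 / r by rewrite divr_ge0 // ltW.
have tB := translation_op_cube_avg h M.
elim: N F C0 C1 => [|N IH] F C0 C1 C00 C10 gF.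
  by rewrite muln0 mulr0n mulr0 addr0 !expr0 !mul1r.
rewrite mulnS addSn add1n !iterSr.
have tL := translation_op_iter _ N (translation_op_diff_neg_laplacian h).
(* Two cube averages pass through the outer [N] Laplacians, so that the induction hypothesis applies
   to the twice averaged Laplacian of [F]. *)
rewrite !(translation_op_comm _ _ _ tB tL).
have nr0 : 0 <= r *+ n by rewrite mulrn_wge0 // ltW.
have k0 : 0 <= k by rewrite mulr_ge0 // exprn_ge0.
have := IH (cube_avg h M (cube_avg h M (diff_neg_laplacian h F)))
  (k * (C0 + C1 * (r *+ n *+ 2))) (k * C1).
have -> : k ^+ N * (k * (C0 + C1 * (r *+ n *+ 2)) + k * C1 * (r *+ n *+ (2 * N)))
    = k ^+ N.+1 * (C0 + C1 * (r *+ n *+ (2 * N).+2)).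
  by rewrite !mulrS mulr0n exprSr; ring.
rewrite exprSr mulrA; apply.
- by rewrite mulr_ge0 // addr_ge0 // mulr_ge0 // mulrn_wge0.
- by rewrite mulr_ge0.
rewrite cube_avg2_diff_neg_laplacian => x; rewrite normrN.
apply: (le_trans (ler_norm_sum _ _ _)).
have -> : k * (C0 + C1 * (r *+ n *+ 2)) + k * C1 * `|x| =
    \sum_(i < n) ((2 / r) ^+ 2 * (C0 + C1 * (r *+ n *+ 2)) +
                  (2 / r) ^+ 2 * C1 * `|x|).
  rewrite sumr_const card_ord -mulr_natl /k; ring.
apply: ler_sum => i _.
have g1 := cube_avg_diffq_growth h M i _ _ _ h0 M0 C00 C10 gF.
have := cube_avg_diffq_growth h M i _ _ _ h0 M0 _ _ g1 x.
rewrite -/r => /(_ _ _)/le_trans; apply.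
- by rewrite mulr_ge0 // addr_ge0 // mulr_ge0.
- by rewrite mulr_ge0.
by rewrite le_eqVlt; apply/orP; left; apply/eqP; ring.
Qed.

(** The average looks forward by at most [r], so a lower bound on a cube passes to the cube with
    side shortened by [r]. Shortening every coordinate, not just the [i]-th, keeps the region a
    cube; this is why a cube average costs [r *+ n] below. *)
Lemma avg_ge h M i F (b c r : R) : 0 <= h -> M%:R * h <= r -> (0 < M)%N ->
  (forall x, (forall j, 0 <= x 0 j <= b) -> c <= F x) ->
  forall x, (forall j, 0 <= x 0 j <= b - r) -> c <= avg h M i F x.
Proof.
move=> h0 Mr M0 Fc x xb; rewrite /avg mulrC ler_pdivlMr ?ltr0n //.
have -> : c * M%:R = \sum_(k < M) c by rewrite sumr_const card_ord mulr_natr.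
apply: ler_sum => k _; apply: Fc => j; rewrite !mxE /=.
have /andP[x0 xr] := xb j.
have kr : k%:R * h <= r.
  by apply: le_trans Mr; rewrite ler_wpM2r // ler_nat ltnW.
have k0 : 0 <= k%:R * h by rewrite mulr_ge0.
case: (j == i); rewrite ?mulr1 ?mulr0; lra.
Qed.

Lemma iter_cube_avg_ge h M k F (b c r : R) :
  0 <= h -> M%:R * h <= r -> (0 < M)%N ->
  (forall x, (forall j, 0 <= x 0 j <= b) -> c <= F x) ->
  forall x, (forall j, 0 <= x 0 j <= b - r *+ n *+ k) ->
  c <= iter k (cube_avg h M) F x.
Proof.
move=> h0 Mr M0; elim: k b F => [|k IH] b F Fc; first by rewrite subr0.
rewrite mulrSr iterSr => x xb.
apply: (IH (b - r *+ n)); last by move=> j; move: (xb j);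
  rewrite opprD addrA addrAC.
have foldr_ge (s : seq 'I_n) y :
    (forall j, 0 <= y 0 j <= b - r *+ size s) -> c <= foldr (avg h M) F s y.
  elim: s y => [|i s IHs] /=; first by rewrite subr0.
  by rewrite mulrSr opprD addrA; apply: avg_ge.
by move=> y yb; apply: foldr_ge => j; rewrite size_enum_ord.
Qed.

End DifferenceOperators.

(** * Partial derivatives as limits of iterated difference quotients *)

Section PartialDerivatives.
Context {R : realType} {n : nat}.
Implicit Types (f g : 'rV[R]_n -> R) (x y : 'rV[R]_n) (i j : 'I_n).

Let e i : 'rV[R]_n := delta_mx 0 i.

Lemma derive_shift f (w v x : 'rV[R]_n) :
  (derivable f (x + w) v -> derivable (fun y => f (y + w)) x v) /\
  'D_v (fun y => f (y + w)) x = 'D_v f (x + w).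
Proof.
rewrite /derivable /derive.
have -> : (fun h => h^-1 *: (((fun y => f (y + w)) \o shift x) (h *: v) - f (x + w)))
  = (fun h : R => h^-1 *: ((f \o shift (x + w)) (h *: v) - f (x + w))).
  by apply/funext => h /=; rewrite addrA.
by [].
Qed.

(** Reduces directional derivatives to one real variable, where the mean value theorem and the rules
    for [is_derive] apply. *)
Lemma is_derive_line f x v (t d : R) :
  is_derive t (1 : R) (fun s => f (x + s *: v)) d <->
  is_derive (x + t *: v) v f d.
Proof.
have qE : (fun k : R => k^-1 *:
      (((fun s => f (x + s *: v)) \o shift t) (k *: (1 : R)) - f (x + t *: v))) =
    (fun k : R => k^-1 *: ((f \o shift (x + t *: v)) (k *: v) - f (x + t *: v))).
  apply/funext => k /=; congr (_ *: (f _ - _)).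
  by rewrite addrCA -scalerDl [k *: 1]mulr1.
by split=> -[df <-]; apply: DeriveDef; move: df;
  rewrite /derivable /derive qE.
Qed.

Lemma partial_scale f (c : R) i : (forall x, derivable f x (e i)) ->
  (forall x, derivable (fun y => c * f y) x (e i)) /\
  partial i (fun y => c * f y) = fun x => c * partial i f x.
Proof.
move=> df; split=> [x|]; first exact: derivableZ.
by apply/funext => x; exact: deriveZ.
Qed.

Lemma partial_sum (I : Type) (r : seq I) (f : I -> 'rV[R]_n -> R) i :
  (forall k x, derivable (f k) x (e i)) ->
  (forall x, derivable (fun y => \sum_(k <- r) f k y) x (e i)) /\
  partial i (fun y => \sum_(k <- r) f k y) =
    fun x => \sum_(k <- r) partial i (f k) x.
Proof.
move=> df; elim: r => [|k r [dr pr]].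
  under [X in partial i X]eq_fun do rewrite big_nil.
  under [X in _ = X]eq_fun do rewrite big_nil.
  split=> [x|].
    under eq_fun do rewrite big_nil.
    exact: derivable_cst.
  by apply/funext => x; exact: derive_cst.
have sumE : (fun y => \sum_(k <- k :: r) f k y) =
    f k + (fun y => \sum_(k <- r) f k y).
  by apply/funext => y; rewrite big_cons.
rewrite sumE; split=> [x|]; first exact: derivableD.
apply/funext => x; rewrite big_cons -(congr1 (@^~ x) pr); exact: deriveD.
Qed.

Lemma partial_translation_op (T : ('rV[R]_n -> R) -> 'rV[R]_n -> R) f i :
  translation_op T -> (forall x, derivable f x (e i)) ->
  (forall x, derivable (T f) x (e i)) /\ partial i (T f) = T (partial i f).
Proof.
move=> [s ->] df.
pose g (p : R * 'rV[R]_n) y := f (y + p.2).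
have dg p x : derivable (g p) x (e i) by apply: (derive_shift _ _ _ _).1.
have sc p := partial_scale (g p) p.1 i (dg p).
have [ds ps] := partial_sum _ s (fun p y => p.1 * g p y) i (fun p => (sc p).1).
split=> //; rewrite [LHS]ps; apply/funext => x; apply: eq_bigr => p _.
rewrite (sc p).2; congr (_ * _); exact: (derive_shift _ _ _ _).2.
Qed.

Lemma of_class_C_continuous k f : of_class_C k f -> continuous f.
Proof. by case: k => [|k] []. Qed.

Lemma of_class_C_scale k (c : R) f :
  of_class_C k f -> of_class_C k (fun x => c * f x).
Proof.
elim: k f => [|k IH] f [cf pf].
  by split=> // x; exact: (cvgM (cvg_cst c) (cf x)).
split=> [x|i]; first by exact: (cvgM (cvg_cst c) (cf x)).
have [df Cf] := pf i; have [dc ->] := partial_scale f c i df.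
by split=> //; exact: IH.
Qed.

Lemma of_class_C_sum (I : Type) k (r : seq I) (f : I -> 'rV[R]_n -> R) :
  (forall a, of_class_C k (f a)) -> of_class_C k (fun x => \sum_(a <- r) f a x).
Proof.
have cs (g : I -> 'rV[R]_n -> R) : (forall a, continuous (g a)) ->
    continuous (fun x => \sum_(a <- r) g a x).
  by move=> cg; apply: continuous_big => //; exact: add_continuous.
elim: k f => [|k IH] f Cf.
  by split=> //; apply: cs => a; exact: (of_class_C_continuous _ _ (Cf a)).
split=> [|i].
  by apply: cs => a; exact: (of_class_C_continuous _ _ (Cf a)).
have [//|dr ->] := partial_sum _ r f i.
  by move=> a; have [_ /(_ i) []] := Cf a.
by split=> //; apply: IH => a; have [_ /(_ i) []] := Cf a.
Qed.

Lemma neg_laplacianE f :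
  neg_laplacian f = fun x => -1 * \sum_(i < n) partial i (partial i f) x.
Proof. by apply/funext => x; rewrite mulN1r. Qed.

Lemma of_class_C_neg_laplacian k f :
  of_class_C k.+2 f -> of_class_C k (neg_laplacian f).
Proof.
move=> [_ Cf]; rewrite neg_laplacianE.
apply: of_class_C_scale; apply: of_class_C_sum => i.
by have [_ [_ /(_ i) []]] := Cf i.
Qed.

Lemma iter_neg_laplacian_scale N (c : R) f : of_class_C (2 * N) f ->
  iter N neg_laplacian (fun x => c * f x) = fun x => c * iter N neg_laplacian f x.
Proof.
elim: N f => [//|N IH] f; rewrite mulnS add2n => Cf.
rewrite !iterSr -IH; last exact: of_class_C_neg_laplacian.
congr iter; rewrite !neg_laplacianE; apply/funext => x.
rewrite mulrCA; congr (_ * _); rewrite mulr_sumr; apply: eq_bigr => i _.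
have [_ /(_ i) [df [_ /(_ i) [ddf _]]]] := Cf.
by rewrite (partial_scale _ _ _ df).2 (partial_scale _ _ _ ddf).2.
Qed.

Lemma iter_neg_laplacian_sum (I : Type) N (r : seq I) (f : I -> 'rV[R]_n -> R) :
  (forall a, of_class_C (2 * N) (f a)) ->
  iter N neg_laplacian (fun x => \sum_(a <- r) f a x) =
  fun x => \sum_(a <- r) iter N neg_laplacian (f a) x.
Proof.
elim: N f => [//|N IH] f; rewrite mulnS add2n => Cf.
rewrite iterSr; under [RHS]eq_fun do under eq_bigr do rewrite iterSr.
rewrite -IH; last by move=> a; exact: of_class_C_neg_laplacian.
congr iter; rewrite neg_laplacianE; apply/funext => x.
under [RHS]eq_bigr do rewrite neg_laplacianE.
rewrite -mulr_sumr exchange_big /=; congr (_ * _); apply: eq_bigr => i _.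
have df a : forall y, derivable (f a) y (e i) by have [_ /(_ i) []] := Cf a.
have ddf a : forall y, derivable (partial i (f a)) y (e i).
  by have [_ /(_ i) [_ [_ /(_ i) []]]] := Cf a.
by rewrite (partial_sum _ r _ _ df).2 (partial_sum _ r _ _ ddf).2.
Qed.

Lemma diffq_partial (h : R) i f x : 0 < h ->
  (forall y, derivable f y (e i)) ->
  exists y, `|y - x| <= h /\ diffq h i f x = partial i f y.
Proof.
move=> h0 df.
pose phi (t : R) := f (x + t *: e i).
have dphi (t : R) : is_derive t 1 phi (partial i f (x + t *: e i)).
  by apply/is_derive_line; apply: DeriveDef.
have cphi : {within `[0, h], continuous phi}.
  apply: continuous_subspaceT => t; apply: differentiable_continuous.
  by apply/derivable1_diffP; case: (dphi t).
have [t /itvP tI E] := MVT h0 (fun t _ => dphi t) cphi.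
exists (x + t *: e i); split.
  rewrite addrC addKr normrZ ger0_norm ?tI // -[leRHS]mulr1.
  by apply: ler_pM; rewrite ?tI // norm_delta_mx.
rewrite /diffq; move: E; rewrite /phi scale0r addr0 subr0 => ->.
by rewrite mulrC mulfK // gt_eqF.
Qed.

(** The mean value theorem turns the outermost difference into a partial derivative at a nearby
    point; this derivative commutes with the remaining differences, and the induction continues with
    [partial i f]. Hence [foldr] on one side and [foldl] on the other. *)
Lemma foldr_diffq_partial (h : R) (l : seq 'I_n) f x : 0 < h ->
  of_class_C (size l) f ->
  exists y, `|y - x| <= (size l)%:R * h /\
    foldr (diffq h) f l x = foldl (fun g i => partial i g) f l y.
Proof.
move=> h0; elim: l f x => [|i l IH] f x /=.
  by exists x; rewrite subrr normr0 mul0r.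
move=> [_ /(_ i) [df Cf]].
have tT : translation_op (fun f => foldr (diffq h) f l).
  by apply: translation_op_foldr => j; exact: translation_op_diffq.
have [dT pT] := partial_translation_op _ _ _ tT df.
have [y [yx ->]] := diffq_partial h i _ x h0 dT; rewrite pT.
have [z [zy ->]] := IH _ y Cf; exists z; split => //.
rewrite mulrSr mulrDl mul1r -[z](subrK y) -addrA.
by apply: (le_trans (ler_normD _ _)); exact: lerD.
Qed.

Lemma closed_ball_compact (r : R) : compact [set x : 'rV[R]_n | `|x| <= r].
Proof.
apply: bounded_closed_compact.
  exists r; split; first exact: num_real.
  by move=> M rM x /= /le_trans; apply; exact: ltW.
have -> : [set x : 'rV[R]_n | `|x| <= r] =
    (fun x : 'rV[R]_n => `|x|) @^-1` [set t | t <= r] by [].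
by apply: preimage_closed; [move=> x _; exact: norm_continuous|exact: closed_le].
Qed.

(** Heine-Cantor by covering with balls of half radius. The point [y] may leave the ball, as mean
    value points do. *)
Lemma unif_continuous_on_balls f (r eps : R) : continuous f -> 0 < eps ->
  exists2 d, 0 < d & forall x, `|x| <= r ->
    forall y, `|y - x| <= d -> `|f y - f x| <= eps.
Proof.
move=> cf e0.
have /compact_near_coveringP/(_ R (0^'+)
  (fun d x => forall y, `|y - x| <= d -> `|f y - f x| <= eps)) :=
  closed_ball_compact r.
move=> H; suff unif : \forall d \near 0^'+, forall x, `|x| <= r ->
    forall y, `|y - x| <= d -> `|f y - f x| <= eps.
  have [d [/= ud d0]] := filter_ex (filterI unif (nbhs_right_gt (0 : R))).
  by exists d.
apply: H => x _.
have e20 : 0 < eps / 2 by rewrite divr_gt0.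
have /cvgrPdist_lt/(_ _ e20)/nbhs_ballP [d /= d0 fd] := cf x.
have d20 : 0 < d / 2 by rewrite divr_gt0.
exists (ball x (d / 2), [set t | t < d / 2]).
  split=> /=; first exact: nbhsx_ballx.
  exact: nbhs_right_lt.
move=> [x' t] /= [xx' td] y yx'.
rewrite -[f y](subrK (f x)) -addrA [eps]splitr.
move: xx'; rewrite -ball_normE /= => xx'.
apply: (le_trans (ler_normD _ _)); apply: lerD.
  rewrite distrC; apply/ltW/fd; rewrite -ball_normE /=.
  rewrite -[x](subrK x') -addrA [d]splitr.
  apply: (le_lt_trans (ler_normD _ _)); apply: ltrD => //.
  by rewrite distrC; apply: le_lt_trans td.
apply/ltW/fd; rewrite -ball_normE /=; apply: lt_trans xx' _.
by rewrite ltr_pdivrMr // ltr_pMr // ltr1n.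
Qed.

(** Puts a second difference at the end of the list, where [foldl] applies the corresponding partial
    derivatives last. *)
Lemma foldr_diffq_cat2 (h : R) (l : seq 'I_n) f i :
  foldr (diffq h) f (l ++ [:: i; i]) = diffq h i (diffq h i (foldr (diffq h) f l)).
Proof.
have tT : translation_op (fun f => foldr (diffq h) f l).
  by apply: translation_op_foldr => j; exact: translation_op_diffq.
have tD := translation_op_diffq h i.
by rewrite foldr_cat /= -2!(translation_op_comm _ _ _ tT tD).
Qed.

(* Stated with a prefix [l] of extra differences so that the induction on [N]
   can absorb the second differences produced by one discrete Laplacian. *)
Lemma iter_diff_neg_laplacian_cvg N (l : seq 'I_n) f (r eps : R) :
  of_class_C (size l + 2 * N) f -> 0 < eps ->
  \forall h \near 0^'+, forall x, `|x| <= r ->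
    `|iter N (diff_neg_laplacian h) (foldr (diffq h) f l) x -
      iter N neg_laplacian (foldl (fun g i => partial i g) f l) x| <= eps.
Proof.
have Cl (k : nat) (s : seq 'I_n) (g : 'rV[R]_n -> R) :
    of_class_C (size s + k) g -> of_class_C k (foldl (fun g i => partial i g) g s).
  by elim: s g => //= i s IHs g [_ /(_ i) [_ /IHs]].
elim: N l eps => [|N IH] l eps Cf e0.
  rewrite muln0 addn0 in Cf; rewrite /=.
  have cf : continuous (foldl (fun g i => partial i g) f l).
    by apply: (of_class_C_continuous 0); apply: Cl; rewrite addn0.
  have [d d0 ud] := unif_continuous_on_balls _ r eps cf e0.
  (* The successor covers the empty list, just as [n.+1] below covers dimension 0. *)
  have d'0 : 0 < d / (size l).+1%:R by rewrite divr_gt0 // ltr0n.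
  near=> h; move=> x xr.
  have h0 : 0 < h by near: h; exact: nbhs_right_gt.
  have [y [yx ->]] := foldr_diffq_partial h l f x h0 Cf.
  apply: ud => //; apply: (le_trans yx).
  have hd : h < d / (size l).+1%:R by near: h; exact: nbhs_right_lt.
  move: hd; rewrite ltr_pdivlMr ?ltr0n // mulrSr mulrDr mulr1 mulrC => hd.
  by apply/ltW/(lt_trans _ hd); rewrite ltrDl.
have en0 : 0 < eps / n.+1%:R by rewrite divr_gt0 // ltr0n.
have Cl2 i : of_class_C (size (l ++ [:: i; i]) + 2 * N) f.
  by rewrite size_cat -addnA; rewrite mulnS in Cf.
have : \forall h \near 0^'+, forall i x, `|x| <= r ->
    `|iter N (diff_neg_laplacian h) (foldr (diffq h) f (l ++ [:: i; i])) x -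
      iter N neg_laplacian (foldl (fun g i => partial i g) f (l ++ [:: i; i])) x|
    <= eps / n.+1%:R.
  by apply: filter_forall => i; exact: IH.
apply: filterS => h Hh x xr.
have tL : translation_op (iter N (@diff_neg_laplacian R n h)).
  by apply: translation_op_iter; exact: translation_op_diff_neg_laplacian.
rewrite !iterSr.
have -> : iter N (diff_neg_laplacian h) (diff_neg_laplacian h (foldr (diffq h) f l)) =
    fun x => - \sum_(i < n) iter N (diff_neg_laplacian h)
      (foldr (diffq h) f (l ++ [:: i; i])) x.
  rewrite [in LHS](_ : diff_neg_laplacian h (foldr (diffq h) f l) = fun x =>
    - \sum_(i < n) foldr (diffq h) f (l ++ [:: i; i]) x); last first.
    apply/funext => y; congr (- _); apply: eq_bigr => i _.
    by rewrite foldr_diffq_cat2.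
  by rewrite (translation_opN _ _ tL) (translation_op_sum _ _ _ _ tL).
rewrite neg_laplacianE.
set w := foldl _ f l.
have Cw i : of_class_C (2 * N) (partial i (partial i w)).
  by have := Cl _ _ _ (Cl2 i); rewrite foldl_cat.
rewrite iter_neg_laplacian_scale; last exact: of_class_C_sum.
rewrite iter_neg_laplacian_sum // mulN1r opprK addrC -sumrB.
apply: (le_trans (ler_norm_sum _ _ _)).
have : \sum_(i < n) (eps / n.+1%:R) <= eps.
  rewrite sumr_const card_ord -[leLHS]mulr_natr mulrAC ler_pdivrMr ?ltr0n //.
  by rewrite ler_pM2l // ler_nat.
apply: le_trans; apply: ler_sum => i _.
by have := Hh i x xr; rewrite foldl_cat distrC.
Unshelve. all: by end_near.
Qed.

End PartialDerivatives.

(** * The comparison function [bubble] and its iterated Laplacians *)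

Section Bubble.
Context {R : realType} {n : nat}.
Implicit Types (f g : 'rV[R]_n -> R) (x y : 'rV[R]_n) (i j : 'I_n).

Let e i : 'rV[R]_n := delta_mx 0 i.

Definition bubble x : R := Num.sqrt (1 + \sum_(i < n) x 0 i ^+ 2).

Lemma bubble_sqr x : bubble x ^+ 2 = 1 + \sum_(i < n) x 0 i ^+ 2.
Proof. by rewrite sqr_sqrtr // addr_ge0 // sumr_ge0 // => i _; exact: sqr_ge0. Qed.

Lemma bubble_gt0 x : 0 < bubble x.
Proof.
by rewrite sqrtr_gt0 ltr_pwDl // sumr_ge0 // => i _; exact: sqr_ge0.
Qed.

Lemma bubble_neq0 x : bubble x != 0.
Proof. by rewrite gt_eqF // bubble_gt0. Qed.

Lemma is_derive_coord i j x :
  is_derive x (e i) (fun y : 'rV[R]_n => y 0 j) (j == i)%:R.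
Proof.
rewrite -[x]addr0 -(scale0r (e i)); apply/is_derive_line.
under eq_fun do rewrite !mxE /=.
by apply: is_derive_eq; rewrite /GRing.scale /=; ring.
Qed.

Lemma is_derive_bubble i x :
  is_derive x (e i) bubble (x 0 i * (bubble x)^-1).
Proof.
have lineE : (fun t : R => bubble (x + t *: e i)) =
    Num.sqrt \o (fun t => bubble x ^+ 2 + t * (2 * x 0 i) + t ^+ 2).
  apply/funext => t /=; congr Num.sqrt; rewrite bubble_sqr -!addrA; congr (1 + _).
  rewrite (bigD1 i) //= [in RHS](bigD1 i) //= !mxE !eqxx mulr1.
  have -> : \sum_(j < n | j != i) (x + t *: e i) 0 j ^+ 2 =
      \sum_(j < n | j != i) x 0 j ^+ 2.
    apply: eq_bigr => j ji; rewrite !mxE (negbTE ji) mulr0 addr0 //.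
  ring.
rewrite -{1}[x]addr0 -(scale0r (e i)); apply/is_derive_line; rewrite lineE.
have sq0 : bubble x ^+ 2 + 0 * (2 * x 0 i) + 0 ^+ 2 = bubble x ^+ 2.
  by rewrite mul0r expr0n !addr0.
have b0 := bubble_gt0 x.
have ds : is_derive (bubble x ^+ 2 + 0 * (2 * x 0 i) + 0 ^+ 2) 1 (@Num.sqrt R)
    (2 * bubble x)^-1.
  have := @is_derive1_sqrt R (bubble x ^+ 2); rewrite exprn_gt0 // => /(_ isT).
  by rewrite sqrtr_sqr gtr0_norm // sq0.
have dp : is_derive (0 : R) 1 (fun t => bubble x ^+ 2 + t * (2 * x 0 i) + t ^+ 2)
    (2 * x 0 i).
  apply: is_derive_eq; rewrite /GRing.scale /=; ring.
have -> : x 0 i * (bubble x)^-1 = (2 * bubble x)^-1 * (2 * x 0 i).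
  by field; exact: bubble_neq0.
exact: is_derive1_comp.
Qed.

Lemma is_derive_bubbleV i x :
  is_derive x (e i) (fun y => (bubble y)^-1) (- (x 0 i * (bubble x)^-1 ^+ 3)).
Proof.
have [dq qE] := is_derive_bubble i x; have b0 := bubble_neq0 x.
apply: DeriveDef; first exact: derivableV.
by rewrite deriveV // qE /GRing.scale /=; field.
Qed.

(** Polynomials in the coordinates, [bubble] and its inverse: a class stable under [partial], which
    yields [of_class_C k] for every [k] at once. *)
Inductive smooth : ('rV[R]_n -> R) -> Prop :=
| smooth_cst c : smooth (fun=> c)
| smooth_coord j : smooth (fun x => x 0 j)
| smooth_bubble : smooth bubble
| smooth_bubbleV : smooth (fun x => (bubble x)^-1)
| smoothD f g : smooth f -> smooth g -> smooth (fun x => f x + g x)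
| smoothM f g : smooth f -> smooth g -> smooth (fun x => f x * g x).

Lemma smooth_continuous f : smooth f -> continuous f.
Proof.
have cq : continuous bubble.
  have cs : continuous (fun x : 'rV[R]_n => \sum_(j < n) x 0 j ^+ 2).
    apply: continuous_big => [|j _ x]; first exact: add_continuous.
    have cj := @coord_continuous R 1 n 0 j.
    exact: (cvgM (cj x) (cj x)).
  move=> x; have c1 := cvgD (cvg_cst (1 : R)) (cs x).
  apply: (@continuous_comp _ _ _ (fun y : 'rV[R]_n => 1 + \sum_(j < n) y 0 j ^+ 2)
    (@Num.sqrt R)); first exact: c1.
  exact: sqrt_continuous.
elim=> {f} [c|j||||].
- exact: cst_continuous.
- exact: (@coord_continuous R 1 n 0 j).
- exact: cq.
- by move=> x; exact: (cvgV (bubble_neq0 x) (cq x)).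
- by move=> f g _ cf _ cg x; exact: (cvgD (cf x) (cg x)).
- by move=> f g _ cf _ cg x; exact: (cvgM (cf x) (cg x)).
Qed.

Lemma partialM f g i : (forall x, derivable f x (e i)) ->
  (forall x, derivable g x (e i)) ->
  partial i (fun x => f x * g x) =
    fun x => f x * partial i g x + g x * partial i f x.
Proof. by move=> df dg; apply/funext => x; exact: deriveM. Qed.

Lemma smooth_partial f i : smooth f ->
  (forall x, derivable f x (e i)) /\ smooth (partial i f).
Proof.
elim=> {f} [c|j|||f g _ [df sf] _ [dg sg]|f g sf' [df sf] sg' [dg sg]].
- split=> [x|]; first exact: derivable_cst.
  have -> : partial i (fun=> c : R) = fun=> 0; last exact: smooth_cst.
  by apply/funext => x; exact: derive_cst.
- split=> [x|]; first by case: (is_derive_coord i j x).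
  have -> : partial i (fun x => x 0 j) = fun=> (j == i)%:R; last exact: smooth_cst.
  by apply/funext => x; case: (is_derive_coord i j x).
- split=> [x|]; first by case: (is_derive_bubble i x).
  have -> : partial i bubble = fun x => x 0 i * (bubble x)^-1.
    by apply/funext => x; case: (is_derive_bubble i x).
  by apply: smoothM; [exact: smooth_coord|exact: smooth_bubbleV].
- split=> [x|]; first by case: (is_derive_bubbleV i x).
  have -> : partial i (fun x => (bubble x)^-1) =
      fun x => (-1 * x 0 i) * ((bubble x)^-1 * ((bubble x)^-1 * (bubble x)^-1)).
    apply/funext => x; have [_] := is_derive_bubbleV i x.
    by rewrite /partial => ->; rewrite !exprS expr0; ring.
  apply: smoothM; first by apply: smoothM; [exact: smooth_cst|exact: smooth_coord].
  by do 2 (apply: smoothM; first exact: smooth_bubbleV); exact: smooth_bubbleV.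
- split=> [x|]; first exact: derivableD.
  have -> : partial i (fun x => f x + g x) = fun x => partial i f x + partial i g x.
    by apply/funext => x; exact: deriveD.
  exact: smoothD.
- split=> [x|]; first exact: derivableM.
  by rewrite partialM //; apply: smoothD; exact: smoothM.
Qed.

Lemma smooth_of_class_C k f : smooth f -> of_class_C k f.
Proof.
elim: k f => [|k IH] f sf; split=> //; try exact: smooth_continuous.
by move=> i; have [df sp] := smooth_partial _ i sf; split=> //; exact: IH.
Qed.

(* [bubble] to the power [1 - 2 * m]. *)
Definition bubble_pow m x : R := bubble x * (bubble x)^-1 ^+ (2 * m).

Lemma bubble_powS m x :
  bubble_pow m.+1 x = bubble_pow m x * ((bubble x)^-1 * (bubble x)^-1).
Proof. by rewrite /bubble_pow mulnS exprD expr2 mulrA mulrAC. Qed.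

Lemma smooth_bubble_pow m : smooth (bubble_pow m).
Proof.
elim: m => [|m IH].
  have -> : bubble_pow 0 = bubble; last exact: smooth_bubble.
  by apply/funext => x; rewrite /bubble_pow muln0 expr0 mulr1.
have -> : bubble_pow m.+1 =
    fun x => bubble_pow m x * ((bubble x)^-1 * (bubble x)^-1).
  by apply/funext => x; rewrite bubble_powS.
by apply: smoothM => //; apply: smoothM; exact: smooth_bubbleV.
Qed.

Lemma partial_bubble_pow m i :
  partial i (bubble_pow m) =
    fun x => (1 - 2 * m%:R) * (x 0 i * bubble_pow m.+1 x).
Proof.
elim: m => [|m IH]; apply/funext => x; have b0 := bubble_neq0 x.
  have -> : bubble_pow 0 = bubble.
    by apply/funext => y; rewrite /bubble_pow muln0 expr0 mulr1.
  have [_] := is_derive_bubble i x; rewrite /partial => ->.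
  by rewrite /bubble_pow; field.
have E : bubble_pow m.+1 =
    fun x => bubble_pow m x * ((bubble x)^-1 * (bubble x)^-1).
  by apply/funext => y; rewrite bubble_powS.
have [dm _] := smooth_partial _ i (smooth_bubble_pow m).
have [dV _] := smooth_partial _ i smooth_bubbleV.
have [dVV _] := smooth_partial _ i (smoothM _ _ smooth_bubbleV smooth_bubbleV).
rewrite [in LHS]E partialM // partialM // IH !bubble_powS.
have [_] := is_derive_bubbleV i x; rewrite /partial => ->.
by rewrite -natr1; field.
Qed.

(** With [s = 1 - 2 * m] this is -Delta b^s = -s(n+s-2) b^(s-2) + s(s-2) b^(s-4), where |x|^2 has
    been replaced by b^2 - 1. *)
Lemma neg_laplacian_bubble_pow m :
  neg_laplacian (bubble_pow m) = fun x =>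
    (2 * m%:R - 1) * ((n%:R - 1 - 2 * m%:R) * bubble_pow m.+1 x +
                      (2 * m%:R + 1) * bubble_pow m.+2 x).
Proof.
apply/funext => x; rewrite neg_laplacianE.
have b0 := bubble_neq0 x.
have ppE i : partial i (partial i (bubble_pow m)) x =
    (1 - 2 * m%:R) * bubble_pow m.+1 x +
    (1 - 2 * m%:R) * (1 - 2 * m.+1%:R) * bubble_pow m.+2 x * x 0 i ^+ 2.
  have [dm _] := smooth_partial _ i (smooth_bubble_pow m.+1).
  have [dc _] := smooth_partial _ i (smooth_coord i).
  have [dcm _] := smooth_partial _ i
    (smoothM _ _ (smooth_coord i) (smooth_bubble_pow m.+1)).
  rewrite partial_bubble_pow (partial_scale _ _ _ dcm).2 partialM //.
  have [_] := is_derive_coord i i x; rewrite {2}/partial => ->.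
  by rewrite partial_bubble_pow eqxx (_ : true%:R = 1 :> R) //; ring.
under eq_bigr do rewrite ppE.
rewrite big_split /= sumr_const card_ord -mulr_sumr.
have -> : \sum_(i < n) x 0 i ^+ 2 = bubble x ^+ 2 - 1.
  by rewrite bubble_sqr addrC addKr.
rewrite -[_ *+ n]mulr_natr -natr1 !bubble_powS; by field.
Qed.

Lemma bubble_pow_gt0 m x : 0 < bubble_pow m x.
Proof. by rewrite mulr_gt0 ?exprn_gt0 ?invr_gt0 ?bubble_gt0. Qed.

(* The coefficients of [(-Delta)^j bubble] in dimension [2 * N - 1]; the falling
   factorial vanishes at [j = N] unless [i = N]. *)
Let dcoef (m : nat) : R := \prod_(k < m) (2 * k%:R - 1).
Let coef (N j i : nat) : R :=
  dcoef (j + i) * ('C(j, i) * 2 ^ (j - i) * (N.-1 - i) ^_ (j - i))%:R.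

Let dcoefS m : dcoef m.+1 = dcoef m * (2 * m%:R - 1).
Proof. exact: big_ord_recr. Qed.

(** The recurrence dictated by [neg_laplacian_bubble_pow] at [m = j + i], since n - 1 - 2m = 2(N - 1
    - m) for n = 2N - 1: its first term keeps [i], its second raises [i] by one. *)
Let coefS (N j i : nat) : (j < N)%N ->
  coef N j.+1 i = (2 * (j + i)%:R - 1) * (2 * (N%:R - 1 - (j + i)%:R)) * coef N j i +
    (if i is i'.+1 then
       (2 * (j + i')%:R - 1) * (2 * (j + i')%:R + 1) * coef N j i' else 0).
Proof.
move=> jN; rewrite /coef; case: i => [|i].
  rewrite !addn0 !bin0 !subn0 !mul1n dcoefS ffactnSr expnS !natrM.
  have -> : (N.-1 - j)%:R = N%:R - 1 - j%:R :> R.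
    by rewrite natrB -?subn1 ?natrB //; lia.
  by ring.
rewrite !addnS !addSn !dcoefS subSS.
(* For [i = j] the coefficient at [i.+1] of row [j] is zero; for [j < i] all binomials vanish. *)
case: (ltngtP i j) => [ij|ji|->]; last first.
- rewrite (bin_small (ltnSn j)) !binn !subnn !ffactn0 !expn0 !mul0n -natr1; ring.
- by rewrite !bin_small ?ltnS ?mul0n ?mulr0 ?addr0 // ltnW.
(* Expressing [N] and [j] through [a] and [k] removes every truncated subtraction. *)
have [a Na] : exists a, N = (a + i).+2 by exists (N - i.+2)%N; lia.
have [k jk] : exists k, j = (k + i).+1 by exists (j - i.+1)%N; lia.
have -> : (j - i = k.+1)%N by lia.
have -> : (j - i.+1 = k)%N by lia.
have -> : (N.-1 - i.+1 = a)%N by lia.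
have -> : (N.-1 - i = a.+1)%N by lia.
have ka : (k <= a)%N by lia.
rewrite ffactnSr ffactSS binS expnS !natrM -[(j + i).+1%:R]natr1 !natrD natrB //.
have binE : i.+1%:R * 'C(j, i.+1)%:R = k.+1%:R * 'C(j, i)%:R :> R.
  by rewrite -!natrM mul_bin_left; congr (_ * _)%:R; lia.
have -> : N%:R = a%:R + i%:R + 2 :> R by rewrite Na -!natr1 natrD; ring.
have -> : j%:R = k%:R + i%:R + 1 :> R by rewrite jk -natr1 natrD.
apply/eqP; rewrite -subr_eq0; apply/eqP.
move: (dcoef (j + i)) ('C(j, i.+1)%:R : R) ('C(j, i)%:R : R) ((2 ^ k)%:R : R)
  ((a ^_ k)%:R : R) binE => D c1 c0 P F binE.
(* The difference of the two sides is a multiple of that of [binE]. *)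
transitivity (D * (2 * (k%:R + i%:R + 1 + i%:R) - 1) *
    (2 * (k%:R + i%:R + 1 + i%:R) + 1) * 2 * P * F *
    (i.+1%:R * c1 - k.+1%:R * c0)); first by rewrite -!natr1; ring.
by rewrite binE subrr mulr0.
Qed.

Let iter_neg_laplacian_bubble_sum (N j : nat) :
  n = (2 * N - 1)%N -> (0 < N)%N -> (j <= N)%N ->
  iter j neg_laplacian bubble =
    fun x => \sum_(i < N.+1) coef N j i * bubble_pow (j + i) x.
Proof.
move=> nN N0; elim: j => [_|j IH jN].
  apply/funext => x /=; rewrite big_ord_recl big1 => [|i _].
    rewrite /coef /dcoef big_ord0 bin0 ffactn0 expn0 !mul1r addr0.
    by rewrite /bubble_pow muln0 expr0 mulr1.
  by rewrite /coef bin_small // !mul0n mulr0 mul0r.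
rewrite iterS IH 1?ltnW //.
have Csum (i : 'I_N.+1) : of_class_C (2 * 1)
    (fun x => coef N j i * bubble_pow (j + i) x).
  by apply: smooth_of_class_C; apply: smoothM;
    [exact: smooth_cst|exact: smooth_bubble_pow].
apply/funext => x.
have /= -> := congr1 (@^~ x) (iter_neg_laplacian_sum _ 1 (index_enum _) _ Csum).
transitivity (\sum_(i < N.+1) (
    (2 * (j + i)%:R - 1) * (2 * (N%:R - 1 - (j + i)%:R)) * coef N j i *
      bubble_pow (j + i).+1 x +
    (2 * (j + i)%:R - 1) * (2 * (j + i)%:R + 1) * coef N j i *
      bubble_pow (j + i).+2 x)).
  apply: eq_bigr => i _.
  have := iter_neg_laplacian_scale 1 (coef N j i) (bubble_pow (j + i))
    (smooth_of_class_C _ _ (smooth_bubble_pow _)).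
  rewrite /= => ->; rewrite neg_laplacian_bubble_pow.
  have -> : n%:R = 2 * N%:R - 1 :> R.
    by rewrite nN natrB ?natrM // muln_gt0.
  by ring.
under [RHS]eq_bigr do rewrite coefS // mulrDl.
rewrite !big_split /=; congr (_ + _).
(* The second family is reindexed by [i + 1]; its term [i = N], which would leave the range, is zero
   because [j < N]. *)
rewrite [LHS]big_ord_recr [RHS]big_ord_recl /= mul0r add0r.
rewrite [coef N j N]/coef bin_small // !mul0n !mulr0 mul0r addr0.
by apply: eq_bigr => i _; rewrite /bump /= add1n addSn addnS.
Qed.

(** At [j = N] only the term [i = N] survives. Its coefficient is the product of 2k - 1 over k < 2N,
    whose only negative factor is the one at k = 0. *)
Lemma iter_neg_laplacian_bubble N : n = (2 * N - 1)%N -> (0 < N)%N ->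
  exists2 d : R, d < 0 &
    iter N neg_laplacian bubble = fun x => d * bubble_pow (2 * N) x.
Proof.
move=> nN N0; exists (dcoef (2 * N)).
  have [m ->] : exists m, (2 * N = m.+1)%N by exists (2 * N - 1)%N; lia.
  elim: m => [|m IH]; first by rewrite dcoefS /dcoef big_ord0 mulr0 mul1r; lra.
  by rewrite dcoefS nmulr_rlt0 // -natr1; have := ler0n R m; lra.
rewrite (iter_neg_laplacian_bubble_sum N) //; apply/funext => x.
rewrite big_ord_recr big1 /= => [|i _].
  by rewrite add0r /coef binn subnn ffactn0 expn0 !mul1n mulr1 addnn mul2n.
rewrite /coef ffact_small ?muln0 ?mulr0 ?mul0r //.
by have := ltn_ord i; lia.
Qed.

End Bubble.

(** * Comparison of norms and growth of [u - alpha * bubble] *)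

Section EuclideanNorm.
Context {R : realType} {n : nat}.
Implicit Types (x : 'rV[R]_n) (u : 'rV[R]_n -> R).

Lemma coord_le_norm x i : `|x 0 i| <= `|x|.
Proof.
rewrite -[leRHS]/(mx_norm x) mx_normrE.
exact: (le_bigmax_cond _ (fun ij : 'I_1 * 'I_n => `|x ij.1 ij.2|) (j := (0, i))).
Qed.

Lemma norm_le x (r : R) : 0 <= r -> (forall i, `|x 0 i| <= r) -> `|x| <= r.
Proof.
move=> r0 xr; rewrite -[leLHS]/(mx_norm x) mx_normrE.
by apply/bigmax_leP; split=> // -[a b] _; rewrite ord1.
Qed.

Lemma enorm_ge0 x : 0 <= enorm x.
Proof. exact: sqrtr_ge0. Qed.

Lemma enorm_sqr x : enorm x ^+ 2 = \sum_(i < n) x 0 i ^+ 2.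
Proof. by rewrite sqr_sqrtr // sumr_ge0 // => i _; exact: sqr_ge0. Qed.

Lemma norm_le_enorm x : `|x| <= enorm x.
Proof.
apply: norm_le => [|i]; first exact: enorm_ge0.
rewrite -ler_sqr ?nnegrE ?enorm_ge0 // enorm_sqr real_normK ?num_real //.
by rewrite (bigD1 i) //= lerDl sumr_ge0 // => j _; exact: sqr_ge0.
Qed.

Lemma enorm_le_norm x : enorm x <= n%:R * `|x|.
Proof.
rewrite -ler_sqr ?nnegrE ?enorm_ge0 ?mulr_ge0 // enorm_sqr exprMn.
apply: (@le_trans _ _ (\sum_(i < n) `|x| ^+ 2)).
  apply: ler_sum => i _; rewrite -[x 0 i ^+ 2]real_normK ?num_real //.
  by rewrite ler_sqr ?nnegrE // coord_le_norm.
rewrite sumr_const card_ord -[leLHS]mulr_natl ler_wpM2r ?sqr_ge0 //.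
by rewrite -natrX ler_nat -[leqLHS]expn1; case: (n) => // k; exact: leq_pexp2l.
Qed.

Lemma enorm_le_bubble x : enorm x <= bubble x.
Proof.
rewrite -ler_sqr ?nnegrE ?enorm_ge0 ?(ltW (bubble_gt0 x)) //.
by rewrite enorm_sqr bubble_sqr lerDr.
Qed.

Lemma bubble_le_enorm x : bubble x <= 1 + enorm x.
Proof.
have e0 := enorm_ge0 x.
rewrite -ler_sqr ?nnegrE ?addr_ge0 ?(ltW (bubble_gt0 x)) //.
by rewrite bubble_sqr -enorm_sqr sqrrD expr1n mul1r; lra.
Qed.

(** The quantitative form of o(|x|): compactness bounds the difference on a ball, the limit bounds
    it outside. The summand [alpha] in the constant absorbs the gap of at most 1 between [bubble]
    and [enorm]. *)
Lemma sub_bubble_growth u (alpha eps : R) : 0 < alpha -> 0 < eps ->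
  continuous u -> u x / enorm x @[x --> enorm_pinfty] --> alpha ->
  exists2 C, 0 <= C & lin_growth C eps (fun x => u x - alpha * bubble x).
Proof.
move=> a0 e0 cu ulim.
(* Pays for passing from the Euclidean norm to the sup norm. *)
pose eps' := eps / n.+1%:R.
have e'0 : 0 < eps' by rewrite divr_gt0 // ltr0n.
have [M _ uM] := ulim _ (nbhsx_ballx alpha eps' e'0).
(* The maximum with 0 makes [enorm x] invertible beyond [M']. *)
pose M' := Num.max M 0.
have cg : continuous (fun x => u x - alpha * bubble x).
  have cb := smooth_continuous _ (@smooth_bubble R n).
  by move=> x; exact: (cvgB (cu x) (cvgM (cvg_cst alpha) (cb x))).
have /compact_bounded [C [_ Cb]] : compact ((fun x => u x - alpha * bubble x) @`
    [set x : 'rV[R]_n | `|x| <= M']).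
  apply: continuous_compact; last exact: closed_ball_compact.
  exact: continuous_subspaceT.
pose C' := Num.max (C + 1) 0.
have C'0 : 0 <= C' by rewrite le_max lexx orbT.
exists (C' + alpha); first by rewrite addr_ge0 // ltW.
move=> x; have ex0 : 0 <= eps * `|x| by rewrite mulr_ge0 // ltW.
have [xM|xM] := leP (enorm x) M'.
  have : `|u x - alpha * bubble x| <= C'.
    apply: (Cb C'); first by rewrite lt_max ltrDl ltr01.
    by exists x => //=; exact: le_trans (norm_le_enorm x) xM.
  lra.
move: xM; rewrite gt_max => /andP[/uM + x0].
rewrite -ball_normE /= => ux.
have : `|alpha * enorm x - u x| <= eps' * enorm x.
  have -> : alpha * enorm x - u x = (alpha - u x / enorm x) * enorm x.
    by rewrite mulrBl divfK // gt_eqF.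
  by rewrite normrM (gtr0_norm x0) ler_wpM2r ?ltW.
have : eps' * enorm x <= eps * `|x|.
  rewrite /eps' mulrAC ler_pdivrMr ?ltr0n // -mulrA ler_wpM2l ?(ltW e0) //.
  apply: (le_trans (enorm_le_norm x)).
  by rewrite mulrC ler_wpM2l // ler_nat.
have : alpha * enorm x <= alpha * bubble x.
  by rewrite ler_wpM2l ?(ltW a0) // enorm_le_bubble.
have : alpha * bubble x <= alpha * (1 + enorm x).
  by rewrite ler_wpM2l ?(ltW a0) // bubble_le_enorm.
by rewrite !ler_norml; lra.
Qed.

(** On the unit cube 1 <= b <= b^2 <= n + 1, and the leading factor b of [bubble_pow] is bounded
    below by 1. *)
Lemma bubble_pow_ge m x : (forall j, 0 <= x 0 j <= 1) ->
  n.+1%:R^-1 ^+ (2 * m) <= bubble_pow m x.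
Proof.
move=> x01.
have b1 : 1 <= bubble x.
  rewrite -[1]sqrtr1 ler_wsqrtr // lerDl.
  by rewrite sumr_ge0 // => i _; exact: sqr_ge0.
have bn : bubble x <= n.+1%:R.
  apply: (@le_trans _ _ (bubble x ^+ 2)).
    by rewrite expr2 ler_peMl // ltW ?bubble_gt0.
  rewrite bubble_sqr -natr1 addrC lerD2r -[n in leRHS]card_ord -sum1_card natr_sum.
  apply: ler_sum => i _; have /andP[x0 x1] := x01 i.
  by rewrite expr_le1.
rewrite -[leLHS]mul1r; apply: ler_pM => //.
apply: lerXn2r; rewrite ?nnegrE ?invr_ge0 ?(ltW (bubble_gt0 x)) //.
by rewrite lef_pV2 ?posrE ?ltr0n ?bubble_gt0.
Qed.

End EuclideanNorm.

(** * Sums over integer translates *)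

Section LatticeSum.
Context {R : realType} {n : nat}.
Implicit Types (F : 'rV[R]_n -> R) (x : 'rV[R]_n).

Definition lattice_pt (K : nat) (c : {ffun 'I_n -> 'I_K}) : 'rV[R]_n :=
  \row_j (c j)%:R.

Lemma norm_lattice_pt K (c : {ffun 'I_n -> 'I_K}) : `|lattice_pt K c| <= K%:R.
Proof.
apply: norm_le => // j; rewrite mxE normr_nat ler_nat; exact: ltnW.
Qed.

(** One translate falls in the unit cube and contributes [kap]; each of the (K+1)^n translates loses
    at most [eta]. *)
Lemma lattice_sum_ge K F (kap eta : R) :
  (forall x, `|x| <= 2 * K.+1%:R -> - eta <= F x) ->
  (forall x, `|x| <= 2 * K.+1%:R -> (forall j, 0 <= x 0 j <= 1) ->
    kap - eta <= F x) ->
  forall x, (forall j, 0 <= x 0 j <= K%:R) ->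
  kap - eta * (K.+1 ^ n)%:R <=
    \sum_(c : {ffun 'I_n -> 'I_K.+1}) F (x - lattice_pt K.+1 c).
Proof.
move=> Fge Fkap x xK.
have xn : `|x| <= K.+1%:R.
  apply: norm_le => // j; have /andP[x0 xk] := xK j.
  by rewrite ger0_norm //; apply: (le_trans xk); rewrite ler_nat.
have ball (c : {ffun 'I_n -> 'I_K.+1}) : `|x - lattice_pt K.+1 c| <= 2 * K.+1%:R.
  apply: (le_trans (ler_normB _ _)); rewrite mulrDl mul1r.
  by apply: lerD => //; exact: norm_lattice_pt.
(* Coordinatewise integer parts; the index set ['I_K.+1] includes the value [K], reached when a
   coordinate equals [K]. *)
pose c0 : {ffun 'I_n -> 'I_K.+1} := [ffun j => inord (Num.truncn (x 0 j))].
have Fc0 : kap - eta <= F (x - lattice_pt K.+1 c0).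
  apply: Fkap => // j; rewrite !mxE ffunE.
  have /andP[x0 xk] := xK j; have /andP[t0 t1] := truncn_itv x0.
  rewrite inordK; last by rewrite ltnS -(ler_nat R); exact: le_trans t0 xk.
  by rewrite subr_ge0 t0 lerBlDr addrC natr1 ltW.
rewrite (bigD1 c0) //=.
have : \sum_(c : {ffun 'I_n -> 'I_K.+1} | c != c0) (- eta) <=
    \sum_(c | c != c0) F (x - lattice_pt K.+1 c).
  by apply: ler_sum => c _; exact: Fge.
have <- : - eta + \sum_(c : {ffun 'I_n -> 'I_K.+1} | c != c0) (- eta) =
    - (eta * (K.+1 ^ n)%:R).
  have -> : - (eta * (K.+1 ^ n)%:R) = \sum_(c : {ffun 'I_n -> 'I_K.+1}) (- eta).
    by rewrite sumr_const card_ffun !card_ord -mulNr mulr_natr.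
  by rewrite [RHS](bigD1 c0).
lra.
Qed.

End LatticeSum.

(** * Choice of scales and the contradiction *)

Theorem theorem1p2 (R : realType) (N : nat) (alpha : R)
    (hN : (2 <= N)%N) (halpha : 0 < alpha) :
  ~ exists u : 'rV[R]_(2 * N - 1) -> R,
      [/\ forall x, 0 < u x,
          of_class_C (2 * N) u,
          forall x, iter N neg_laplacian u x = u x ^- (4 * N - 1) &
          u x / enorm x @[x --> enorm_pinfty] --> alpha].
Proof.
move=> [u [u0 Cu eq_u ulim]].
have N0 : (0 < N)%N by lia.
move: u u0 Cu eq_u ulim; set n := (2 * N - 1)%N => u u0 Cu eq_u ulim.
have [d d0 bubbleE] := @iter_neg_laplacian_bubble R n N erefl N0.
(* A lower bound on the unit cube for (-Delta)^N (u - alpha b), by [bubble_pow_ge]. *)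
pose kap : R := alpha * - d * n.+1%:R^-1 ^+ (2 * (2 * N)).
have kap0 : 0 < kap.
  by rewrite !mulr_gt0 ?oppr_gt0 // exprn_gt0 // invr_gt0 ltr0n.
(* [A] and [P] do not depend on the side [l]; they serve in the bounds K + 1 <= l A and (K+1)^n k^N
   <= P / l below. *)
pose A : R := (n * (2 * N)).+1%:R.
pose P : R := A ^+ n * (n%:R * 2 ^+ 2) ^+ N.
have A0 : 0 < A by rewrite ltr0n.
have n0 : (0 < n)%N by rewrite /n; lia.
have n1 : (2 * N = n.+1)%N by rewrite /n; lia.
have P0 : 0 < P by rewrite mulr_gt0 ?exprn_gt0 // mulr_gt0 ?ltr0n.
(* Makes the slope part of the final upper bound equal to [kap / 8]; the choice of [l] below makes
   the constant part smaller than [kap / 8]. *)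
pose eps := kap / (16 * P * A).
have e0 : 0 < eps by rewrite divr_gt0 // mulr_gt0 // mulr_gt0.
have [C C0 gC] := sub_bubble_growth u alpha eps halpha e0
  (of_class_C_continuous _ _ Cu) ulim.
set g := (fun x => _) in gC.
pose l := (Num.truncn (8 * P * C / kap)).+1.
have l0 : 0 < (l%:R : R) by rewrite ltr0n.
(* The [2 * N] cube averages of side [l] shorten a cube by exactly this length, so the cube of side
   [K] shrinks to the origin. *)
pose K := (l * n * (2 * N))%N.
(* The discretization errors of all (K+1)^n translates add up to [kap / 2]; the factor [1 + alpha]
   below shares [eta] between [u] and [alpha * bubble]. *)
pose eta : R := kap / (2 * (K.+1 ^ n)%:R).
have K0 : 0 < (K.+1 ^ n)%:R :> R by rewrite ltr0n expn_gt0.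
have eta0 : 0 < eta by rewrite divr_gt0 // mulr_gt0.
have eta2 : 0 < eta / (1 + alpha) by rewrite divr_gt0 // addr_gt0.
(* The step is the inverse of an integer, so that the integer side [l] is a multiple of it. *)
have [h [h0 [m mh]] hP] : exists2 h : R, 0 < h /\ (exists m, m%:R * h = 1) &
    forall x, `|x| <= 2 * K.+1%:R ->
    `|iter N (diff_neg_laplacian h) u x - iter N neg_laplacian u x|
      <= eta / (1 + alpha) /\
    `|iter N (diff_neg_laplacian h) bubble x - iter N neg_laplacian bubble x|
      <= eta / (1 + alpha).
  have cvu := iter_diff_neg_laplacian_cvg N [::] u (2 * K.+1%:R) _ Cu eta2.
  have Cb : of_class_C (size (Nil 'I_n) + 2 * N) (@bubble R n).
    by apply: smooth_of_class_C; exact: smooth_bubble.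
  have cvb := iter_diff_neg_laplacian_cvg N [::] bubble (2 * K.+1%:R) _ Cb eta2.
  have [del /= del0 Hdel] := filterI cvu cvb.
  pose m := (Num.truncn del^-1).+1.
  have m0 : 0 < (m%:R : R) by rewrite ltr0n.
  exists m%:R^-1; first by split; [rewrite invr_gt0|exists m; rewrite divff // gt_eqF].
  have [||Hu Hb] := Hdel m%:R^-1.
  - rewrite /= sub0r normrN gtr0_norm ?invr_gt0 //.
    rewrite -[ltRHS]invrK ltf_pV2 ?posrE ?invr_gt0 //.
    exact: truncnS_gt.
  - by rewrite /= invr_gt0.
  by move=> x xK; split; [exact: Hu|exact: Hb].
pose F := iter N (diff_neg_laplacian h) g.
have FE : F = fun x => iter N (diff_neg_laplacian h) u x -
    alpha * iter N (diff_neg_laplacian h) bubble x.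
  apply: translation_opBZ; apply: translation_op_iter.
  exact: translation_op_diff_neg_laplacian.
(* The equation enters only through the positivity of (-Delta)^N u, whose value is dropped. *)
have Fge x : `|x| <= 2 * K.+1%:R ->
    alpha * - d * bubble_pow (2 * N) x - eta <= F x.
  move=> /hP; rewrite FE eq_u bubbleE !ler_distl => -[/andP[Hu _] /andP[_ Hb]].
  have : 0 < u x ^- (4 * N - 1) by rewrite invr_gt0 exprn_gt0.
  have := ler_wpM2l (ltW halpha) Hb.
  have : eta = eta / (1 + alpha) + alpha * (eta / (1 + alpha)).
    by field; rewrite gt_eqF // addr_gt0.
  lra.
have ad0 : 0 < alpha * - d by rewrite mulr_gt0 // oppr_gt0.
have sum_ge : forall x : 'rV[R]_n, (forall j, 0 <= x 0 j <= K%:R) -> kap / 2 <=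
    \sum_(c : {ffun 'I_n -> 'I_K.+1}) F (x - lattice_pt K.+1 c).
  move=> x xK.
  have := lattice_sum_ge K F kap eta _ _ x xK.
  have -> : kap - eta * (K.+1 ^ n)%:R = kap / 2.
    by rewrite /eta; field; rewrite gt_eqF.
  apply=> y yK.
    apply: le_trans (Fge y yK); rewrite lerDr mulr_ge0 ?ltW //.
    exact: bubble_pow_gt0.
  move=> y01; apply: le_trans (Fge y yK); rewrite lerD2r ler_wpM2l ?(ltW ad0) //.
  exact: bubble_pow_ge.
pose M := (m * l)%N.
have Mh : M%:R * h = l%:R by rewrite natrM mulrAC mh mul1r.
have M0 : (0 < M)%N.
  by rewrite -(ltr0n R) -(pmulr_lgt0 _ h0) Mh.
have tB := translation_op_iter _ (2 * N) (@translation_op_cube_avg R n h M).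
(* Evaluate the averages of the lattice sum at the origin, then move them inside the sum and past
   the translations. *)
have low : kap / 2 <= \sum_(c : {ffun 'I_n -> 'I_K.+1})
    iter (2 * N) (cube_avg h M) F (0 - lattice_pt K.+1 c).
  have := iter_cube_avg_ge h M (2 * N) _ K%:R _ l%:R (ltW h0) _ M0 sum_ge 0.
  rewrite Mh lexx (translation_op_sum _ _ _ _ tB) => /(_ isT).
  have -> : K%:R - l%:R *+ n *+ (2 * N) = 0 :> R.
    by rewrite /K natrM mulr_natr natrM mulr_natr subrr.
  move=> /(_ _)/le_trans; apply; first by move=> j; rewrite mxE lexx.
  apply: ler_sum => c _.
  by rewrite (translation_op_shift _ F _ tB).
pose k : R := n%:R * (2 / l%:R) ^+ 2.
have k0 : 0 <= k by rewrite mulr_ge0 // sqr_ge0.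
have KA : K.+1%:R <= l%:R * A :> R.
  rewrite /A /K -natrM ler_nat mulnS -mulnA.
  exact: (leq_add (ltn0Sn _ : (1 <= l)%N) (leqnn _)).
have up (c : {ffun 'I_n -> 'I_K.+1}) :
    iter (2 * N) (cube_avg h M) F (0 - lattice_pt K.+1 c) <=
    k ^+ N * (C + 2 * eps * (l%:R * A)).
  apply: (le_trans (ler_norm _)).
  have := iter_cube_avg_growth h M N g C eps h0 M0 C0 (ltW e0) gC
    (0 - lattice_pt K.+1 c).
  rewrite Mh => /le_trans; apply.
  set X := l%:R *+ n *+ (2 * N); set Y := `|_|; rewrite -/k.
  have -> : k ^+ N * (C + eps * X) + k ^+ N * eps * Y = k ^+ N * (C + eps * (X + Y)).
    by ring.
  have -> : 2 * eps * (l%:R * A) = eps * (l%:R * A + l%:R * A) by ring.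
  apply: ler_wpM2l; first exact: exprn_ge0.
  rewrite lerD2l; apply: ler_wpM2l; first exact: ltW.
  rewrite /X /Y sub0r normrN; apply: lerD.
    by apply: le_trans KA; rewrite -!mulrnA ler_nat leqW // mulnA.
  exact: le_trans (norm_lattice_pt _ _) KA.
have : kap / 2 <= (K.+1 ^ n)%:R * (k ^+ N * (C + 2 * eps * (l%:R * A))).
  apply: (le_trans low).
  have -> : (K.+1 ^ n)%:R * (k ^+ N * (C + 2 * eps * (l%:R * A))) =
      \sum_(c : {ffun 'I_n -> 'I_K.+1}) k ^+ N * (C + 2 * eps * (l%:R * A)).
    by rewrite sumr_const card_ffun !card_ord mulr_natl.
  by apply: ler_sum => c _; exact: up.
(* The dimension count: (K+1)^n grows like l^n while k^N decays like l^(-2N), and 2N = n + 1 leaves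
   1 / l. *)
have Pl : (K.+1 ^ n)%:R * k ^+ N <= P / l%:R.
  have -> : P / l%:R = (l%:R * A) ^+ n * k ^+ N.
    have -> : k ^+ N = (n%:R * 2 ^+ 2) ^+ N / l%:R ^+ n.+1.
      by rewrite -n1 /k expr_div_n mulrA expr_div_n -[l%:R ^+ 2 ^+ N]exprM.
    rewrite /P; set Q := (_ * 2 ^+ 2) ^+ N; rewrite exprMn exprS; field.
    by rewrite expf_neq0 gt_eqF.
  rewrite ler_wpM2r ?exprn_ge0 // natrX lerXn2r ?nnegrE //.
  by rewrite mulr_ge0 // ltW.
have b0 : 0 <= C + 2 * eps * (l%:R * A) 
  by apply: addr_ge0 => //; apply: mulr_ge0; apply: mulr_ge0; rewrite // ltW.
rewrite mulrA => /le_trans/(_ (ler_wpM2r b0 Pl)).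
have -> : P / l%:R * (C + 2 * eps * (l%:R * A)) = P * C / l%:R + kap / 8.
  by rewrite /eps; field; rewrite !gt_eqF.
have : P * C / l%:R < kap / 8.
  rewrite ltr_pdivrMr // [ltRHS]mulrC -ltr_pdivrMr ?divr_gt0 //.
  have -> : P * C / (kap / 8) = 8 * P * C / kap by field; rewrite gt_eqF.
  exact: truncnS_gt.
lra.
Qed.
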